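(* Let $\mathcal{G}$ be a countable locally finite graph. Then $\mathcal{G}$ is weakly ultrahomogeneous if and only if $\mathcal{G}$ is a disjoint union $\mathcal{G}=\mathcal{H}\cup mK_n$ for some $0\le m\le\omega$ and $1\le n<\omega$ and some finite graph $\mathcal{H}$.
   Context: Graphs are simple and undirected, viewed as structures in the language of one binary relation (adjacency). A graph is locally finite if every vertex has finite degree. $K_n$ is the complete graph on $n$ vertices and $mK_n$ is the disjoint union of $m$ copies of $K_n$. A graph $\mathcal{G}$ is weakly ultrahomogeneous if there is a finite set $\{a_1,\dots,a_k\}$ of vertices such that every isomorphism between finite induced subgraphs of $\mathcal{G}$ containing all $a_i$ and fixing each $a_i$ extends to an automorphism of $\mathcal{G}$. *)

(* Defs.v *)
From mathcomp Require Import all_boot.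
From mathcomp Require Import boolp classical_sets functions cardinality.

Set Implicit Arguments.
Unset Strict Implicit.
Unset Printing Implicit Defensive.

Local Open Scope classical_set_scope.

Record graph := Graph {
  vertex :> Type;
  adj : vertex -> vertex -> Prop;
  adj_sym : forall x y, adj x y -> adj y x;
  adj_irr : forall x, ~ adj x x
}.

Definition is_iso (G H : graph) (f : G -> H) : Prop :=
  bijective f /\ forall x y : G, adj x y <-> adj (f x) (f y).

Definition isomorphic (G H : graph) : Prop := exists f : G -> H, is_iso f.

Definition locally_finite (G : graph) : Prop :=
  forall x : G, finite_set [set y : G | adj x y].

Section Induced.
Variables (G : graph) (A : set G).

Definition induced_adj (x y : set_type A) : Prop := adj (\val x) (\val y).

Lemma induced_adj_sym x y : induced_adj x y -> induced_adj y x.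
Proof. exact: adj_sym. Qed.

Lemma induced_adj_irr x : ~ induced_adj x x.
Proof. exact: adj_irr. Qed.

Definition induced : graph := Graph induced_adj_sym induced_adj_irr.

End Induced.

Definition weakly_ultrahomogeneous (G : graph) : Prop :=
  exists S : set G, finite_set S /\
    forall A B : set G, finite_set A -> finite_set B ->
      S `<=` A -> S `<=` B ->
      forall f : induced A -> induced B, is_iso f ->
        (forall x : induced A, S (\val x) -> \val (f x) = \val x) ->
        exists g : G -> G, is_iso g /\
          forall x : induced A, g (\val x) = \val (f x).

Section DisjointUnion.
Variables G H : graph.

Definition dunion_adj (x y : G + H) : Prop :=
  match x, y with
  | inl a, inl b => adj a b
  | inr a, inr b => adj a b
  | _, _ => False
  end.

Lemma dunion_adj_sym x y : dunion_adj x y -> dunion_adj y x.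
Proof. by case: x => x; case: y => y //=; apply: adj_sym. Qed.

Lemma dunion_adj_irr x : ~ dunion_adj x x.
Proof. by case: x => x; apply: adj_irr. Qed.

Definition dunion : graph := Graph dunion_adj_sym dunion_adj_irr.

End DisjointUnion.

Section Copies.
Variables (I : Type) (G : graph).

Definition copies_adj (x y : I * G) : Prop := x.1 = y.1 /\ adj x.2 y.2.

Lemma copies_adj_sym x y : copies_adj x y -> copies_adj y x.
Proof. by case=> xy1 xy2; split; [rewrite xy1 | apply: adj_sym]. Qed.

Lemma copies_adj_irr x : ~ copies_adj x x.
Proof. by case=> _; apply: adj_irr. Qed.

Definition copies : graph := Graph copies_adj_sym copies_adj_irr.

End Copies.

Section Complete.
Variable n : nat.

Definition complete_adj (x y : 'I_n) : Prop := x <> y.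

Lemma complete_adj_sym x y : complete_adj x y -> complete_adj y x.
Proof. by move=> xy /esym. Qed.

Lemma complete_adj_irr x : ~ complete_adj x x.
Proof. by apply. Qed.

Definition complete : graph := Graph complete_adj_sym complete_adj_irr.

End Complete.

(* A cardinal m <= omega is encoded as an option nat, None standing for
   omega. *)
Definition initial_segment (m : option nat) : Type :=
  if m is Some k then 'I_k else nat.

Definition mK (m : option nat) (n : nat) : graph :=
  copies (initial_segment m) (complete n).

(* Main.v *)
Require Import Defs.
From mathcomp Require Import all_boot.
From mathcomp Require Import boolp classical_sets functions cardinality.

Set Implicit Arguments.
Unset Strict Implicit.
Unset Printing Implicit Defensive.

Local Open Scope classical_set_scope.

(** Suppose first that the graph is [H] together with disjoint copies of
    [K_n], with [H] finite.  Take the vertices of [H] as the fixed set.  A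
    finite partial isomorphism fixing [H] acts on the vertices of the copies;
    it sends two vertices to the same copy exactly when they lie in the same
    copy, so it induces a finite partial injection of the index set of the
    copies and, inside each copy, a finite partial injection of ['I_n].  A
    finite partial injection of a set into itself always extends to a
    permutation ([extend_injection]), and permutations of the indices and of
    the individual copies assemble into an automorphism ([wuh_dunion_mK]).

    Conversely, let [S] be a finite set witnessing weak ultrahomogeneity of
    the graph [G].  If [G] is finite there is nothing to do.  Otherwise let [N]
    be the finite closed neighbourhood of [S].  A vertex outside [N] has no
    relation at all with [S], so every finite partial isomorphism between
    vertices outside [N] extends to an automorphism fixing [S], and such an
    automorphism preserves [N] ([extend_outside]).  Three consequences follow,
    the first two because finitely many finite balls cannot cover the infinite
    complement of [N]:
    - no vertex outside [N] is adjacent to [N]: any other vertex outside [N]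
      is its image under some automorphism preserving [N], hence would be
      adjacent to [N] too ([outside_not_adj]);
    - adjacency is transitive outside [N]: if [x] and [z] are distinct,
      non-adjacent, but have a common neighbour, then, moving [z] and fixing
      [x], so do [x] and every vertex outside [N] not adjacent to [x]
      ([outside_trans]);
    - all closed balls of radius one centred outside [N] have the same size,
      because automorphisms move their centres transitively.
    So the complement of [N] is a disjoint union of cliques of one common
    size, not joined to [N], and there are countably infinitely many of them
    ([outside_transversal]). *)

(** * Isomorphisms *)

Lemma bijective_of_inj_surj (T U : Type) (f : T -> U) :
  injective f -> (forall y, exists x, f x = y) -> bijective f.
Proof.
move=> fI /choice[g gK]; exists g => // x.
by apply: fI; rewrite gK.
Qed.

Lemma is_iso_inv (G H : graph) (f : G -> H) (g : H -> G) :
  is_iso f -> cancel f g -> cancel g f -> is_iso g.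
Proof.
move=> [_ fE] fK gK; split; first by exists f.
by move=> x y; rewrite fE !gK.
Qed.

Lemma is_iso_comp (G H K : graph) (g : H -> K) (f : G -> H) :
  is_iso g -> is_iso f -> is_iso (g \o f).
Proof.
move=> [gB gE] [fB fE]; split; first exact: bij_comp.
by move=> x y; rewrite fE gE.
Qed.

Lemma isomorphic_sym (G H : graph) : isomorphic G H -> isomorphic H G.
Proof.
move=> [f fI]; have [[g fK gK] _] := fI.
by exists g; apply: is_iso_inv fI fK gK.
Qed.

(** * Weak ultrahomogeneity through total functions *)

(** [partial_iso A f]: the restriction of the total function [f] to [A] is an
    isomorphism onto the subgraph induced by [f @` A].  Using total functions
    avoids the dependent types of induced subgraphs. *)
Definition partial_iso (G : graph) (A : set G) (f : G -> G) : Prop :=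
  (forall x y, A x -> A y -> f x = f y -> x = y) /\
  (forall x y, A x -> A y -> adj x y <-> adj (f x) (f y)).

Definition determines_extension (G : graph) (S : set G) : Prop :=
  forall (A : set G) (f : G -> G), finite_set A -> S `<=` A ->
    partial_iso A f -> (forall x, S x -> f x = x) ->
    exists g : G -> G, is_iso g /\ forall x, A x -> g x = f x.

Lemma wuhP (G : graph) :
  weakly_ultrahomogeneous G <->
  exists S : set G, finite_set S /\ determines_extension S.
Proof.
split=> -[S [finS extS]]; exists S; split=> //.
  move=> A f finA SA [fI fE] fS.
  pose B := f @` A.
  have fB (x : induced A) : (f (\val x)) \in B.
    by rewrite inE; exists (\val x) => //; apply: set_valP.
  pose F (x : induced A) : induced B := exist _ (f (\val x)) (fB x).
  have FB : bijective F.
    apply: bijective_of_inj_surj => [x y /(congr1 \val) /= xy|[y yB]].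
      by apply: val_inj; apply: fI xy; apply: set_valP.
    have := yB; rewrite inE => -[x Ax fxy].
    have xA : x \in A by rewrite inE.
    by exists (exist _ x xA); apply: val_inj.
  have SB : S `<=` B by move=> x Sx; exists x; [apply: SA|apply: fS].
  have [||g [gI gE]] := extS A B finA (finite_image _ finA) SA SB F.
  - by split=> // x y; apply: fE; apply: set_valP.
  - by move=> x /fS.
  exists g; split=> // x Ax.
  have xA : x \in A by rewrite inE.
  exact: gE (exist _ x xA).
move=> A B finA finB SA SB f [fB fE] fS.
have /choice[F FE] : forall x, exists y, forall xA : x \in A,
    y = \val (f (exist _ x xA)).
  move=> x; have [xA|xNA] := pselect (x \in A); last by exists x => xA.
  by exists (\val (f (exist _ x xA))) => xA'; rewrite (bool_irrelevance xA' xA).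
have FEval (x : induced A) : F (\val x) = \val (f x).
  by case: x => x xA; rewrite (FE _ xA).
have Fpartial : partial_iso A F.
  split=> x y /mem_set xA /mem_set yA; rewrite (FE _ xA) (FE _ yA).
    by move=> /val_inj/(bij_inj fB)/(congr1 \val).
  exact: (fE (exist _ x xA) (exist _ y yA)).
have [|g [gI gE]] := extS A F finA SA Fpartial.
  move=> x Sx; have /mem_set xA := SA _ Sx.
  by rewrite (FE _ xA) fS.
by exists g; split=> // x; rewrite gE ?FEval//; apply: set_valP.
Qed.

Lemma wuh_isomorphic (G H : graph) :
  isomorphic G H -> weakly_ultrahomogeneous G -> weakly_ultrahomogeneous H.
Proof.
move=> [p pI] /wuhP[S [finS extS]]; apply/wuhP.
have [[q pK qK] pE] := pI.
have qI : is_iso q by apply: is_iso_inv pI pK qK.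
have qE := qI.2.
exists (p @` S); split; first exact: finite_image.
move=> A f finA SA [fI fE] fS.
have qA x : (q @` A) x -> A (p x) by move=> [y Ay <-]; rewrite qK.
have [||||g [gI gE]] := extS (q @` A) (q \o f \o p).
- exact: finite_image.
- by move=> x Sx; exists (p x); [apply: SA; exists x|rewrite pK].
- split=> x y /qA Ax /qA Ay /=.
    by move=> /(can_inj qK)/(fI _ _ Ax Ay)/(can_inj pK).
  by rewrite pE -qE; apply: fE.
- by move=> x Sx /=; rewrite fS ?pK//; exists x.
exists (p \o g \o q); split.
  by apply: is_iso_comp qI; apply: is_iso_comp pI gI.
by move=> x Ax /=; rewrite gE ?/= ?qK//; exists x.
Qed.

(** * Disjoint unions of a finite graph and copies of a complete graph *)

(** Extend one point at a time: if a permutation [g] already agrees with [f]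
    on a list and [x] is a further point, swapping the two values [g x] and
    [f x] after [g] repairs the value at [x], and it leaves the earlier values
    alone since they differ from both. *)
Lemma extend_injection_seq (T : eqType) (s : seq T) (f : T -> T) :
  {in s &, injective f} ->
  exists g : T -> T, bijective g /\ {in s, g =1 f}.
Proof.
elim: s => [|x s IH] fI; first by exists id; split=> //; exists id.
have [y z ys zs|g [gB gE]] := IH; first by apply: fI; rewrite inE ?ys ?zs orbT.
have [xs|xNs] := boolP (x \in s).
  exists g; split=> // y; rewrite inE => /predU1P[->|]; exact: gE.
pose swap u := if u == g x then f x else if u == f x then g x else u.
have swapK : involutive swap.
  move=> u; rewrite /swap; have [->|ux] := eqVneq u (g x).
    by rewrite eqxx; case: eqVneq.
  have [->|uf] := eqVneq u (f x); first by rewrite eqxx.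
  by rewrite (negPf ux) (negPf uf).
exists (swap \o g); split; first by apply: bij_comp => //; exists swap.
move=> y; rewrite inE /= /swap => /predU1P[->|ys]; first by rewrite eqxx.
have yx : y != x by apply: contraNneq xNs => <-.
rewrite (inj_eq (bij_inj gB)) (negPf yx) gE//.
case: eqVneq => // /fI yEx; rewrite yEx ?inE ?eqxx ?ys ?orbT// in yx.
Qed.

Lemma extend_injection (T : Type) (A : set T) (f : T -> T) :
  finite_set A -> (forall x y, A x -> A y -> f x = f y -> x = y) ->
  exists g : T -> T, bijective g /\ forall x, A x -> g x = f x.
Proof.
elim/Pchoice: T => T in A f *.
move=> /finite_seqP[s ->] fI.
by have [x y xs ys|g [gB gE]] := @extend_injection_seq _ s f; [apply: fI|exists g].
Qed.

Lemma extend_injection_inv (T : Type) (A : set T) (f : T -> T) :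
  finite_set A -> (forall x y, A x -> A y -> f x = f y -> x = y) ->
  exists g : (T -> T) * (T -> T),
    [/\ cancel g.1 g.2, cancel g.2 g.1 & forall x, A x -> g.1 x = f x].
Proof.
by move=> finA /(extend_injection finA)[g [[h gK hK] gE]]; exists (g, h).
Qed.

Lemma wuh_dunion_mK (H : graph) (m : option nat) (n : nat) :
  finite_set [set: H] -> weakly_ultrahomogeneous (dunion H (mK m n)).
Proof.
move=> finH; apply/wuhP; exists (inl @` [set: H]); split; first exact: finite_image.
move=> A f finA SA [fI fE] fS.
have {SA} inlA h : A (inl h) by apply: SA; exists h.
have {fS} f_inl h : f (inl h) = inl h by apply: fS; exists h.
pose I := initial_segment m.
(* By injectivity a vertex of a copy is not sent into [H], all of which is
   fixed. *)
have /choice[q qE] : forall p : I * 'I_n, exists q : I * 'I_n,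
    A (inr p) -> f (inr p) = inr q.
  move=> p; case fp : (f (inr p)) => [h|q]; last by exists q.
  exists p => Ap; have : inr p = inl h :> H + _ by apply: fI; rewrite ?f_inl.
  by [].
have q_inj p p' : A (inr p) -> A (inr p') -> q p = q p' -> p = p'.
  move=> Ap Ap' qq; have : inr p = inr p' :> H + _ by apply: fI; rewrite ?qE ?qq.
  by case.
have q_adj p p' : A (inr p) -> A (inr p') ->
    (p.1 = p'.1 /\ p.2 <> p'.2 <-> (q p).1 = (q p').1 /\ (q p).2 <> (q p').2).
  by move=> Ap Ap'; have := fE _ _ Ap Ap'; rewrite !qE.
have q_fst p p' : A (inr p) -> A (inr p') ->
    (p.1 = p'.1 <-> (q p).1 = (q p').1).
  move=> Ap Ap'; split=> e.
    have [e2|ne2] := eqVneq p.2 p'.2.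
      by rewrite [p]surjective_pairing e e2 -surjective_pairing.
    by case: ((q_adj p p' Ap Ap').1 _) => //; split=> //; apply/eqP.
  have [e2|ne2] := eqVneq (q p).2 (q p').2.
    by rewrite (q_inj p p')// [q p]surjective_pairing e e2 -surjective_pairing.
  by case: ((q_adj p p' Ap Ap').2 _) => //; split=> //; apply/eqP.
have /choice[t tE] : forall i, exists j, forall k, A (inr (i, k)) -> (q (i, k)).1 = j.
  move=> i; have [[k Ak]|Nk] := pselect (exists k, A (inr (i, k))).
    by exists (q (i, k)).1 => l Al; apply: (q_fst (i, l) (i, k) Al Ak).1.
  by exists i => k Ak; case: Nk; exists k.
pose AI : set I := [set i | exists k, A (inr (i, k))].
have finAI : finite_set AI.
  (* The copies met by [A] are found among the images of [A] under the map
     sending a vertex to the index of its copy. *)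
  have finX : finite_set
      ((fun x : H + I * 'I_n => if x is inr p then Some p.1 else None) @` A).
    exact: finite_image.
  rewrite -(eq_finite_set (@card_some _ AI)).
  by apply: sub_finite_set finX => _ [i [k Ak] <-]; exists (inr (i, k)).
have [|[s s'] /= [sK s'K sE]] := extend_injection_inv (f := t) finAI.
  move=> i j [k Ak] [l Al] tt.
  by apply: (q_fst (i, k) (j, l) Ak Al).2; rewrite (tE _ _ Ak) (tE _ _ Al).
have /choice[u uE] : forall i, exists g : ('I_n -> 'I_n) * ('I_n -> 'I_n),
    [/\ cancel g.1 g.2, cancel g.2 g.1 &
        forall k, A (inr (i, k)) -> g.1 k = (q (i, k)).2].
  move=> i; have [k l Ak Al qq|g gP] :=
    @extend_injection_inv _ [set k | A (inr (i, k))] (fun k => (q (i, k)).2)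
      (@finite_finset _ _); last by exists g.
  have e : (q (i, k)).1 = (q (i, l)).1 := (q_fst (i, k) (i, l) Ak Al).1 erefl.
  have : (i, k) = (i, l).
    by apply: q_inj => //; rewrite [LHS]surjective_pairing e qq -surjective_pairing.
  by case.
pose g (x : dunion H (mK m n)) : dunion H (mK m n) :=
  match x with inl h => inl h | inr p => inr (s p.1, (u p.1).1 p.2) end.
pose g' (x : dunion H (mK m n)) : dunion H (mK m n) :=
  match x with inl h => inl h | inr p => inr (s' p.1, (u (s' p.1)).2 p.2) end.
exists g; split; last first.
  move=> [h|[i k]] Ax /=; first by rewrite f_inl.
  have [_ _ uik] := uE i.
  rewrite qE// sE; last by exists k.
  by rewrite -(tE _ _ Ax) uik// -surjective_pairing.
split.
  exists g' => [[h|[i k]]|[h|[i k]]] //=.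
    by rewrite sK; have [-> _ _] := uE i.
  by rewrite s'K; have [_ -> _] := uE (s' i).
move=> [h|[i k]] [h'|[j l]] //=; rewrite /copies_adj/= /complete_adj.
have [uK _ _] := uE i.
split=> -[].
  by move=> <- kl; split=> // /(can_inj uK).
by move=> /(can_inj sK) <- kl; split=> // e; apply: kl; rewrite e.
Qed.

(** * Locally finite weakly ultrahomogeneous graphs *)

Definition ball1 (G : graph) (x : G) : set G := [set y | x = y \/ adj x y].

Definition nbhd (G : graph) (A : set G) : set G := \bigcup_(x in A) ball1 x.

Lemma ball1_sym (G : graph) (x y : G) : ball1 x y -> ball1 y x.
Proof. by case=> [->|xy]; [left|right; apply: adj_sym]. Qed.

Lemma sub_nbhd (G : graph) (A : set G) : A `<=` nbhd A.
Proof. by move=> x Ax; exists x => //; left. Qed.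

Lemma ball1_iso (G : graph) (g : G -> G) (x y : G) :
  is_iso g -> ball1 (g x) (g y) <-> ball1 x y.
Proof.
move=> [gB gE]; split=> -[].
- by move=> /(bij_inj gB) ->; left.
- by move=> gxy; right; exact: (gE _ _).2 gxy.
- by move=> ->; left.
- by move=> xy; right; exact: (gE _ _).1 xy.
Qed.

Section Outside.
Variables (G : graph) (S : set G).
Hypotheses (lfG : locally_finite G) (finS : finite_set S).
Hypotheses (infG : infinite_set [set: G]) (extS : determines_extension S).

Lemma finite_ball1 (x : G) : finite_set (ball1 x).
Proof.
have -> : ball1 x = [set x] `|` [set y | adj x y].
  by apply/seteqP; split=> y [->|xy]; by [left|right].
by rewrite finite_setU; split; [exact: finite_set1|exact: lfG].
Qed.

Lemma finite_nbhd (A : set G) : finite_set A -> finite_set (nbhd A).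
Proof. by move=> finA; apply: bigcup_finite => // x _; exact: finite_ball1. Qed.

Let N : set G := nbhd S.
Let D : set G := ~` N.

Lemma infinite_outside : infinite_set D.
Proof.
move=> finD; apply: infG; rewrite -(setUv N) finite_setU; split=> //.
exact: finite_nbhd.
Qed.

Lemma outside_ball1 (x s : G) : D x -> S s -> ~ ball1 s x.
Proof. by move=> Dx Ss sx; apply: Dx; exists s. Qed.

Lemma fixing_nbhd (g : G -> G) (x : G) :
  is_iso g -> (forall s, S s -> g s = s) -> N x -> N (g x).
Proof.
move=> gI gS [s Ss sx]; exists s => //.
by rewrite -{1}(gS s Ss); apply/(ball1_iso _ _ gI).
Qed.

Lemma extend_outside (A : set G) (f : G -> G) :
  finite_set A -> A `<=` D -> (forall x, A x -> D (f x)) -> partial_iso A f ->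
  exists g : G -> G,
    [/\ is_iso g, forall s, S s -> g s = s & forall x, A x -> g x = f x].
Proof.
move=> finA AD fD [fI fE].
pose F x := if pselect (S x) then x else f x.
have FS x : S x -> F x = x by rewrite /F; case: pselect.
have FA x : A x -> F x = f x.
  rewrite /F; case: pselect => // Sx /AD Dx.
  by case: (outside_ball1 Dx Sx); left.
have [||||g [gI gE]] := extS (A := S `|` A) (f := F).
- by rewrite finite_setU.
- by move=> x; left.
- split=> x y [Sx|Ax] [Sy|Ay]; rewrite ?(FS x Sx) ?(FS y Sy) ?(FA x Ax) ?(FA y Ay) //.
  + by move=> e; case: (outside_ball1 (fD _ Ay) Sx); left.
  + by move=> e; case: (outside_ball1 (fD _ Ax) Sy); left.
  + exact: fI.
  + split=> e; first by case: (outside_ball1 (AD _ Ay) Sx); right.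
    by case: (outside_ball1 (fD _ Ay) Sx); right.
  + split=> /adj_sym e; first by case: (outside_ball1 (AD _ Ax) Sy); right.
    by case: (outside_ball1 (fD _ Ax) Sy); right.
  + exact: fE.
- exact: FS.
exists g; split=> // x Xx.
  by rewrite gE ?FS//; left.
by rewrite gE ?FA//; right.
Qed.

Lemma move_outside (x w : G) : D x -> D w ->
  exists g : G -> G, [/\ is_iso g, forall s, S s -> g s = s & g x = w].
Proof.
move=> Dx Dw.
have [||||g [gI gS gE]] := @extend_outside [set x] (fun=> w).
- exact: finite_set1.
- by move=> _ ->.
- by [].
- by split=> y z -> -> //; split=> /adj_irr.
by exists g; split=> //; apply: gE.
Qed.

(** Automorphisms fixing [S] preserve [N] and move any vertex outside [N] to
    any other, so one edge leaving [N] puts all of [D] in the finite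
    neighbourhood of [N]. *)
Lemma outside_not_adj (x y : G) : D x -> N y -> ~ adj x y.
Proof.
move=> Dx Ny xy; apply: infinite_outside.
apply: sub_finite_set (finite_nbhd (finite_nbhd finS)) => w Dw.
have [g [gI gS gx]] := move_outside Dx Dw.
exists (g y); first exact: fixing_nbhd.
by right; apply: adj_sym; rewrite -gx; exact: (gI.2 _ _).1 xy.
Qed.

(** Two vertices violating the conclusion are at distance two, and fixing [x] while moving [z]
    shows that all of [D] lies in the ball of radius two around [x]. *)
Lemma outside_trans (x y z : G) : D x -> D z ->
  adj x y -> adj y z -> ball1 x z.
Proof.
move=> Dx Dz xy yz; apply: contrapT => xz; apply: infinite_outside.
apply: sub_finite_set (finite_nbhd (finite_ball1 x)) => w Dw.
have [xw|xw] := pselect (ball1 x w); first by exists w => //; left.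
have zNx : z <> x by move=> e; apply: xz; left.
pose f u := if pselect (u = x) then x else w.
have fx : f x = x by rewrite /f; case: pselect.
have fz : f z = w by rewrite /f; case: pselect.
have [||||g [gI gS gE]] := @extend_outside [set x; z] f.
- exact: finite_set2.
- by move=> _ [] ->.
- by move=> _ [] ->; rewrite ?fx ?fz.
- split=> _ _ [] -> [] ->; rewrite ?fx ?fz //.
  + by move=> e; case: xw; left.
  + by move=> e; case: xw; left.
  + by split=> e; [case: xz|case: xw]; right.
  + by split=> /adj_sym e; [case: xz|case: xw]; right.
  + by split=> /adj_irr.
have gx : g x = x by rewrite gE ?fx//; left.
have gz : g z = w by rewrite gE ?fz//; right.
exists (g y); right.
  by rewrite -{1}gx; exact: (gI.2 _ _).1 xy.
by rewrite -gz; exact: (gI.2 _ _).1 yz.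
Qed.

Lemma outside_ball1_closed (x y : G) : D x -> ball1 x y -> D y.
Proof. by move=> Dx [<-//|xy] Ny; apply: outside_not_adj xy. Qed.

Lemma outside_ball1_eq (x y : G) : D x -> ball1 x y -> ball1 x = ball1 y.
Proof.
have sub a b : D a -> ball1 a b -> ball1 b `<=` ball1 a.
  move=> Da [->//|ab] c bc; have Db := outside_ball1_closed Da (or_intror ab).
  have Dc := outside_ball1_closed Db bc.
  by case: bc => [<-|bc]; [right|apply: outside_trans ab bc].
move=> Dx xy; have Dy := outside_ball1_closed Dx xy.
by apply/seteqP; split; apply: sub => //; apply: ball1_sym.
Qed.

(** The closed balls centred in [D] partition [D] into finite pieces, so there
    are infinitely many of them; hence a transversal can be indexed by [nat]. *)
Lemma outside_transversal : countable [set: G] ->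
  exists r : nat -> G, [/\ forall i, D (r i),
    forall i j, ball1 (r i) (r j) -> i = j &
    forall x, D x -> exists i, ball1 (r i) x].
Proof.
move=> cG; pose C := (@ball1 G) @` D.
have infC : infinite_set C.
  move=> finC; apply: infinite_outside.
  have : finite_set (\bigcup_(B in C) B).
    by apply: bigcup_finite => // _ [x _ <-]; exact: finite_ball1.
  apply: sub_finite_set => x Dx; exists (ball1 x); last by left.
  by exists x.
have cC : countable C.
  apply: sub_countable cG; apply: card_le_trans (card_image_le _ _) _.
  exact: subset_card_le.
have /card_set_bijP[F [_ Finj Fsurj]] : (C #= [set: nat])%card.
  by apply: Cantor_Bernstein; [exact: cC|apply/infiniteP].
have /choice[r rP] : forall i, exists x, D x /\ F (ball1 x) = i.
  by move=> i; have [_ [x Dx <-] Fx] := Fsurj i I; exists x.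
exists r; split=> [i|i j rij|x Dx].
- exact: (rP i).1.
- by rewrite -(rP i).2 -(rP j).2 (outside_ball1_eq (rP i).1 rij).
- exists (F (ball1 x)).
  have /Finj -> : F (ball1 (r (F (ball1 x)))) = F (ball1 x) by rewrite (rP _).2.
  + by left.
  + by rewrite inE; exists (r (F (ball1 x))) => //; exact: (rP _).1.
  + by rewrite inE; exists x.
Qed.

(** One enumeration of one ball is transported to all balls by automorphisms;
    this gives all of them the same size at once. *)
Lemma outside_enum (r : nat -> G) : (forall i, D (r i)) ->
  exists n (e : nat -> 'I_n -> G), [/\ (1 <= n)%N, forall i, injective (e i),
    forall i k, ball1 (r i) (e i k) &
    forall i x, ball1 (r i) x -> exists k, e i k = x].
Proof.
move=> Dr; have [n /card_set_bijP[F [Ffun Finj Fsurj]]] := finite_ball1 (r 0).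
have /choice[e0 e0P] : forall k : 'I_n, exists x, ball1 (r 0) x /\ F x = k.
  by move=> k; have [x rx Fx] := Fsurj k (ltn_ord k); exists x.
have /choice[g gP] : forall i, exists g : G -> G, is_iso g /\ g (r 0) = r i.
  by move=> i; have [g [gI _ gr]] := move_outside (Dr 0) (Dr i); exists g.
exists n, (fun i k => g i (e0 k)); split=> [|i k l|i k|i x].
- have : F (r 0) < n by apply: Ffun; left.
  exact: leq_trans.
- move=> /(bij_inj (gP i).1.1) e; apply: val_inj.
  by rewrite /= -(e0P k).2 -(e0P l).2 e.
- by rewrite -(gP i).2; apply/(ball1_iso _ _ (gP i).1); exact: (e0P k).1.
- have [[h gK hK] _] := (gP i).1.
  rewrite -(gP i).2 -{1}(hK x) => /(ball1_iso _ _ (gP i).1) hx.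
  exists (Ordinal (Ffun _ hx)).
  have /Finj -> : F (e0 (Ordinal (Ffun _ hx))) = F (h x) by rewrite (e0P _).2.
  + exact: hK.
  + by rewrite inE; exact: (e0P _).1.
  + by rewrite inE.
Qed.

Lemma outside_decomposition : countable [set: G] ->
  exists n, (1 <= n)%N /\ isomorphic (dunion (induced N) (mK None n)) G.
Proof.
move=> /outside_transversal[r [Dr rI rS]].
have [n [e [n_gt0 eI eB eS]]] := outside_enum Dr.
have De i k : D (e i k) by apply: outside_ball1_closed (Dr i) (eB i k).
have eE i k : ball1 (r i) = ball1 (e i k) by apply: outside_ball1_eq.
have e_ball i j k l : ball1 (e i k) (e j l) -> i = j.
  by rewrite -eE => /(outside_ball1_eq (Dr i)) E; apply: rI; rewrite E -eE; left.
exists n; split=> //.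
pose f (x : dunion (induced N) (mK None n)) : G :=
  match x with inl h => \val h | inr p => e p.1 p.2 end.
exists f; split.
  apply: bijective_of_inj_surj => [[h|[i k]] [h'|[j l]] /=|y].
  - by move=> /val_inj ->.
  - by move=> E; case: (De j l); rewrite -E; apply: set_valP.
  - by move=> E; case: (De i k); rewrite E; apply: set_valP.
  - move=> E; have ij : i = j by apply: (e_ball _ _ k l); left.
    by move: E; rewrite ij => /eI ->.
  have [Ny|Dy] := pselect (N y).
    have yN : y \in N by rewrite inE.
    by exists (inl (exist _ y yN)).
  have [i /eS[k <-]] := rS y Dy.
  by exists (inr (i, k)).
move=> [h|[i k]] [h'|[j l]] //=.
- by split=> // /adj_sym; apply: outside_not_adj (De j l) _; apply: set_valP.
- by split=> //; apply: outside_not_adj (De i k) _; apply: set_valP.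
- rewrite /copies_adj/= /complete_adj; split.
    move=> [<- kl]; have : ball1 (e i k) (e i l) by rewrite -eE.
    by case=> // /eI.
  move=> E; have ij : i = j by apply: (e_ball _ _ k l); right.
  by split=> // kl; move: E; rewrite ij kl => /adj_irr.
Qed.

End Outside.

Lemma isomorphic_dunion_empty (G : graph) (n : nat) :
  isomorphic G (dunion G (mK (Some 0) n)).
Proof.
exists inl; split=> //.
by apply: bijective_of_inj_surj => [x y []|[x|[[]//]]] //; exists x.
Qed.

Theorem proposition6p3 (G : graph) (cG : countable [set: G])
    (lfG : locally_finite G) :
  weakly_ultrahomogeneous G <->
  exists (m : option nat) (n : nat) (H : graph),
    (1 <= n)%N /\ finite_set [set: H] /\ isomorphic G (dunion H (mK m n)).
Proof.
split=> [/wuhP[S [finS extS]]|[m [n [H [_ [finH GH]]]]]]; last first.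
  exact: wuh_isomorphic (isomorphic_sym GH) (wuh_dunion_mK m n finH).
have [finG|infG] := pselect (finite_set [set: G]).
  by exists (Some 0), 1, G; do !split=> //; exact: isomorphic_dunion_empty.
have [n [n_gt0 iso]] := outside_decomposition lfG finS infG extS cG.
exists None, n, (induced (nbhd S)); do !split=> //; last exact: isomorphic_sym.
by rewrite (eq_finite_set (card_setT _)); exact: finite_nbhd.
Qed.
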